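(* There is an algorithm that, given a finite-state automaton $\mathcal{S}=(X,T,X_0,\to,\Sigma,\ell)$ and $k_1,k_2\in\mathbb{N}$, decides in polynomial time (polynomial in the size of $\mathcal{S}$ and in $k_1,k_2$) whether $\mathcal{S}$ is $*$-$(k_1,k_2)$-detectable.
   Context: A finite-state automaton (FSA) is a sextuple $\mathcal{S}=(X,T,X_0,\to,\Sigma,\ell)$, where $X$ is a finite set of states, $T$ a finite set of events, $X_0\subset X$ a set of initial states, $\to\subset X\times T\times X$ a transition relation, $\Sigma$ a finite set of labels, and $\ell:T\to\Sigma\cup\{\epsilon\}$ a labeling function ($\epsilon$ is the empty word). No further assumption (deadlock-freeness, absence of unobservable cycles, etc.) is made. $\ell$ is extended to finite event sequences by $\ell(t_1\cdots t_n)=\ell(t_1)\cdots\ell(t_n)$, $\ell(\epsilon)=\epsilon$. For $s=t_1\cdots t_n\in T^*$, $x\xrightarrow{s}x'$ means that there are states $x=x_0,x_1,\dots,x_n=x'$ with $(x_{i-1},t_i,x_i)\in\to$ for all $i$ (so $x\xrightarrow{\epsilon}x$). The size of $\mathcal{S}$ is e.g. $|X|+|T|+|\Sigma|+|\to|$. For $\sigma_1,\sigma_2\in\Sigma^*$ define the delayed state estimate $$\mathcal{M}(\mathcal{S},\sigma_1,\sigma_2)=\{x\in X\mid \exists x_0\in X_0,\ \exists x'\in X,\ \exists s_1,s_2\in T^*:\ \ell(s_1)=\sigma_1,\ \ell(s_2)=\sigma_2,\ x_0\xrightarrow{s_1}x\xrightarrow{s_2}x'\}.$$ The language $\mathcal{L}(\mathcal{S})$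 is the set of $\sigma\in\Sigma^*$ such that $x_0\xrightarrow{s}x$ for some $x_0\in X_0$, $x\in X$, $s\in T^*$ with $\ell(s)=\sigma$. Write $\sigma'\sqsubset\sigma$ if the finite word $\sigma'$ is a prefix of $\sigma$ (possibly equal to $\sigma$). $\mathcal{S}$ is $*$-$(k_1,k_2)$-detectable if for all $\sigma\in\mathcal{L}(\mathcal{S})$ and all $\sigma_1,\sigma_2\in\Sigma^*$ with $\sigma_1\sigma_2\sqsubset\sigma$: if $|\sigma_1|\ge k_1$ and $|\sigma_2|\ge k_2$, then $|\mathcal{M}(\mathcal{S},\sigma_1,\sigma_2)|=1$. *)

(* Defs.v *)
From mathcomp Require Import all_boot all_order all_algebra.
From mathcomp Require Import boolp.

Set Implicit Arguments.
Unset Strict Implicit.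
Unset Printing Implicit Defensive.

Record fsa := FSA {
  state : finType;
  event : finType;
  init : {set state};
  trans : {set state * event * state};
  symbol : finType;
  label : event -> option symbol  (* [None] is the empty word *)
}.

Definition fsa_size (S : fsa) : nat :=
  #|state S| + #|event S| + #|symbol S| + #|trans S|.

Definition label_word (S : fsa) (s : seq (event S)) : seq (symbol S) :=
  pmap (@label S) s.

Fixpoint run (S : fsa) (x : state S) (s : seq (event S)) (x' : state S) : Prop :=
  if s is t :: s' then exists2 y, (x, t, y) \in trans S & run y s' x'
  else x = x'.

Definition language (S : fsa) (w : seq (symbol S)) : Prop :=
  exists x0 x s, [/\ x0 \in init S, run x0 s x & label_word s = w].

Definition delayed_estimate (S : fsa) (w1 w2 : seq (symbol S)) : {set state S} :=
  [set x | `[< exists x0 x' s1 s2,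
     [/\ x0 \in init S, label_word s1 = w1, label_word s2 = w2,
         run x0 s1 x & run x s2 x'] >] ].

Definition detectable (S : fsa) (k1 k2 : nat) : Prop :=
  forall w w1 w2 : seq (symbol S), language w -> prefix (w1 ++ w2) w ->
    k1 <= size w1 -> k2 <= size w2 -> #|delayed_estimate w1 w2| = 1.

(* The model of computation is a random access machine (Cook and Reckhow),
   with registers R_0, R_1, ... over nat, truncated subtraction, and a
   random-access read-only input.  Every instruction costs one unit.  There is
   no multiplication, so t steps only produce numbers whose bit length exceeds
   that of the inputs and program constants by O(t): polynomial time is the
   same as on a Turing machine. *)
Inductive instr :=
| Const of nat & nat        (* Const i c  : R_i := c *)
| Add of nat & nat & nat    (* Add i j k  : R_i := R_j + R_k *)
| Sub of nat & nat & nat    (* Sub i j k  : R_i := R_j - R_k *)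
| Fetch of nat & nat        (* Fetch i j  : R_i := R_(R_j) *)
| Store of nat & nat        (* Store i j  : R_(R_i) := R_j *)
| Read of nat & nat         (* Read i j   : R_i := input cell number R_j *)
| Jump of nat & nat         (* Jump i m   : go to instruction m if R_i > 0 *)
| Halt of bool.             (* Halt b     : stop with answer b *)

Definition program := seq instr.

Definition config := (nat * (nat -> nat))%type.

Definition upd (r : nat -> nat) (i v : nat) : nat -> nat :=
  fun j => if j == i then v else r j.

(* Input cells beyond the end of [inp] read as 0.  A machine whose program
   counter leaves the program is stuck, without an answer. *)
Definition step (P : program) (inp : seq nat) (c : config) : config :=
  let: (pc, r) := c in
  match onth P pc with
  | Some (Const i v) => (pc.+1, upd r i v)
  | Some (Add i j k) => (pc.+1, upd r i (r j + r k))
  | Some (Sub i j k) => (pc.+1, upd r i (r j - r k))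
  | Some (Fetch i j) => (pc.+1, upd r i (r (r j)))
  | Some (Store i j) => (pc.+1, upd r (r i) (r j))
  | Some (Read i j) => (pc.+1, upd r i (nth 0 inp (r j)))
  | Some (Jump i m) => (if 0 < r i then m else pc.+1, r)
  | Some (Halt _) | None => c
  end.

Definition start : config := (0, fun=> 0).

Definition answers_within (P : program) (inp : seq nat) (t : nat) (b : bool)
    : Prop :=
  exists2 n, n <= t & onth P (iter n (step P inp) start).1 = Some (Halt b).

Definition rank (T : finType) (x : T) : nat := enum_rank x.

Definition code_label (S : fsa) (t : event S) : nat :=
  if label t is Some a then (rank a).+1 else 0.

Definition code_trans (S : fsa) (e : state S * event S * state S) : seq nat :=
  let: (x, t, y) := e in [:: rank x; rank t; rank y].

(* All numbers below are at most [fsa_size S + k1 + k2], so nothing is hidden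
   in the size of a single input cell. *)
Definition encode (S : fsa) (k1 k2 : nat) : seq nat :=
  [:: k1; k2; #|state S|; #|event S|; #|symbol S|; #|init S|; #|trans S|]
  ++ [seq rank x | x <- enum (init S)]
  ++ [seq code_label t | t <- enum (event S)]
  ++ flatten [seq code_trans e | e <- enum (trans S)].

(* Main.v *)
Require Import Defs.
From mathcomp Require Import all_boot all_order all_algebra.
From mathcomp Require Import boolp zify.

(* The automaton is not detectable iff two runs with the same labels pass
   simultaneously through two distinct states x, y, after k1 or more
   observations and before k2 or more further ones.  This is a reachability
   question in a graph with O(|X|^2 (k1 + k2)) nodes (c, x, y): the level c
   counts the observations, saturating at k1, then jumps to k1 + 1 when the two
   states are distinct, then counts again, saturating at k1 + k2 + 1.
   Reachability is decided by marking nodes and relaxing all edges as often as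
   there are nodes.

   The marking algorithm is written in a small language whose loops all have the
   same bound M = O(size + k1 + k2), so that any program of the language runs in
   time polynomial in M, whatever it computes; the language is compiled to the
   random access machine. *)

Set Implicit Arguments.
Unset Strict Implicit.
Unset Printing Implicit Defensive.

(** * The marking language *)

(* [Var i] is the index of the [i]-th enclosing loop, counted from the outermost
   one; [Scale e] is [e * M], where [M] is the common bound of all loops. *)
Inductive expr :=
| Lit of nat
| Var of nat
| Plus of expr & expr
| Minus of expr & expr
| Input of expr
| Scale of expr.

(* The memory is a set of marked cells that only grows; conditions cannot test
   that a cell is unmarked, which makes the semantics monotone. *)
Inductive stmt :=
| Mark of expr
| If of expr & stmt
| IfMarked of expr & stmt
| For of stmt
| Seq of stmt & stmt.

Fixpoint eval (inp : seq nat) (M : nat) (rho : seq nat) (e : expr) : nat :=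
  match e with
  | Lit c => c
  | Var i => nth 0 rho i
  | Plus a b => eval inp M rho a + eval inp M rho b
  | Minus a b => eval inp M rho a - eval inp M rho b
  | Input a => nth 0 inp (eval inp M rho a)
  | Scale a => eval inp M rho a * M
  end.

Fixpoint exec (inp : seq nat) (M : nat) (rho : seq nat) (s : stmt)
    (h : pred nat) : pred nat :=
  match s with
  | Mark e => fun a => (a == eval inp M rho e) || h a
  | If e s' => if 0 < eval inp M rho e then exec inp M rho s' h else h
  | IfMarked e s' => if h (eval inp M rho e) then exec inp M rho s' h else h
  | For s' => foldl (fun g k => exec inp M (rcons rho k) s' g) h (iota 0 M)
  | Seq s1 s2 => exec inp M rho s2 (exec inp M rho s1 h)
  end.

Fixpoint scoped_expr (d : nat) (e : expr) : bool :=
  match e with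
  | Lit _ => true
  | Var i => i < d
  | Plus a b | Minus a b => scoped_expr d a && scoped_expr d b
  | Input a | Scale a => scoped_expr d a
  end.

Fixpoint scoped (d : nat) (s : stmt) : bool :=
  match s with
  | Mark e => scoped_expr d e
  | If e s' | IfMarked e s' => scoped_expr d e && scoped d s'
  | For s' => scoped d.+1 s'
  | Seq s1 s2 => scoped d s1 && scoped d s2
  end.

(* Register 0 holds [M]; the others are dealt out by residues modulo 3, so that
   no bound on the number of cells is needed to avoid clashes. *)
Local Notation tmp t := (3 * t + 1).
Local Notation cell a := (3 * a + 2).
Local Notation var i := (3 * i + 3).

(** Jumps are absolute, hence the load address [o]. The result goes to [tmp t], and [tmp u] with
    [u < t] may hold pending operands. [Scale] is repeated addition, for want of a multiplication
    instruction, and tests its counter only after the first round. *)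
Fixpoint compile_expr (o t : nat) (e : expr) : seq instr :=
  match e with
  | Lit c => [:: Const (tmp t) c]
  | Var i => [:: Const (tmp t) 0; Add (tmp t) (var i) (tmp t)]
  | Plus a b =>
      let A := compile_expr o t a in
      A ++ compile_expr (o + size A) t.+1 b
        ++ [:: Add (tmp t) (tmp t) (tmp t.+1)]
  | Minus a b =>
      let A := compile_expr o t a in
      A ++ compile_expr (o + size A) t.+1 b
        ++ [:: Defs.Sub (tmp t) (tmp t) (tmp t.+1)]
  | Input a => compile_expr o t a ++ [:: Read (tmp t) (tmp t)]
  | Scale a =>
      let A := compile_expr o t a in
      A ++ [:: Const (tmp t.+1) 0;
               Add (tmp t.+2) 0 (tmp t.+1);
               Const (tmp t.+3) 1;
               Add (tmp t.+1) (tmp t.+1) (tmp t);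
               Defs.Sub (tmp t.+2) (tmp t.+2) (tmp t.+3);
               Jump (tmp t.+2) (o + size A + 3);
               Add (tmp t) (tmp t.+1) (tmp t.+2)]
  end.

Definition compile_cell (o : nat) (e : expr) : seq instr :=
  compile_expr o 0 e
  ++ [:: Add (tmp 1) (tmp 0) (tmp 0);
         Add (tmp 1) (tmp 1) (tmp 0);
         Const (tmp 0) 2;
         Add (tmp 1) (tmp 1) (tmp 0)].

(** [Jump] tests for a positive register, so the truncated difference [1 - x] serves as negation. *)
Definition skip_if_zero (target : nat) : seq instr :=
  [:: Const (tmp 1) 1; Defs.Sub (tmp 0) (tmp 1) (tmp 0); Jump (tmp 0) target].

Fixpoint compile (o d : nat) (s : stmt) : seq instr :=
  match s with
  | Mark e => compile_cell o e ++ [:: Const (tmp 0) 1; Store (tmp 1) (tmp 0)]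
  | If e s' =>
      let A := compile_expr o 0 e in
      let B := compile (o + size A + 3) d s' in
      A ++ skip_if_zero (o + size A + 3 + size B) ++ B
  | IfMarked e s' =>
      let A := compile_cell o e in
      let B := compile (o + size A + 4) d s' in
      A ++ Fetch (tmp 0) (tmp 1)
        :: skip_if_zero (o + size A + 4 + size B) ++ B
  | For s' =>
      Const (var d) 0 :: compile o.+1 d.+1 s'
        ++ [:: Const (tmp 0) 1; Add (var d) (var d) (tmp 0);
               Defs.Sub (tmp 0) 0 (var d); Jump (tmp 0) o.+1]
  | Seq s1 s2 =>
      let A := compile o d s1 in A ++ compile (o + size A) d s2
  end.

(** These bounds depend on the syntax and on [M] only, never on the input or the memory; guarded
    statements are charged as if executed. *)
Fixpoint cost_expr (M : nat) (e : expr) : nat :=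
  match e with
  | Lit _ => 1
  | Var _ => 2
  | Plus a b | Minus a b => cost_expr M a + cost_expr M b + 1
  | Input a => cost_expr M a + 1
  | Scale a => cost_expr M a + 3 * M + 4
  end.

Fixpoint cost (M : nat) (s : stmt) : nat :=
  match s with
  | Mark e => cost_expr M e + 6
  | If e s' => cost_expr M e + cost M s' + 3
  | IfMarked e s' => cost_expr M e + cost M s' + 8
  | For s' => M * (cost M s' + 4) + 1
  | Seq s1 s2 => cost M s1 + cost M s2
  end.

(** * Correctness of the compiler *)

Arguments onth : simpl never.

Fixpoint code_at (P : program) (o : nat) (C : seq instr) : Prop :=
  if C is i :: C' then onth P o = Some i /\ code_at P o.+1 C' else True.

Lemma code_at_cons P o i C :
  code_at P o (i :: C) <-> onth P o = Some i /\ code_at P o.+1 C.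
Proof. by []. Qed.

Lemma code_at_cat P o C1 C2 :
  code_at P o (C1 ++ C2) <-> code_at P o C1 /\ code_at P (o + size C1) C2.
Proof.
elim: C1 o => [|i C1 IH] o /=; first by rewrite addn0; tauto.
by rewrite IH addSnnS; tauto.
Qed.

Lemma code_at_self C : code_at C 0 C.
Proof.
suff gen pre : code_at (pre ++ C) (size pre) C by apply: (gen [::]).
elim: C pre => //= i C IH pre; split.
  by elim: pre => //=.
by have := IH (rcons pre i); rewrite cat_rcons size_rcons.
Qed.

Section Simulation.

Variables (P : program) (inp : seq nat) (M : nat).
Hypothesis M_gt0 : 0 < M.

(** An upper bound instead of an exact count, because a guarded statement that is skipped takes
    fewer steps than its cost. *)
Definition runs (n : nat) (c c' : config) : Prop :=
  exists2 m, m <= n & iter m (step P inp) c = c'.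

Lemma runs_refl c : runs 0 c c.
Proof. by exists 0. Qed.

Lemma runs_pc pc pc' m : pc = pc' -> runs 0 (pc, m) (pc', m).
Proof. by move->; apply: runs_refl. Qed.

Lemma runs_leq n m c c' : n <= m -> runs n c c' -> runs m c c'.
Proof. by move=> le_nm [k le_kn <-]; exists k => //; apply: leq_trans le_nm. Qed.

Lemma runs_trans c2 n m c1 c3 :
  runs n c1 c2 -> runs m c2 c3 -> runs (n + m) c1 c3.
Proof.
move=> [i le_in <-] [j le_jm <-]; exists (j + i); last exact: iterD.
by rewrite addnC leq_add.
Qed.

Lemma runs_step n c c' : runs n (step P inp c) c' -> runs n.+1 c c'.
Proof. by case=> i le_in <-; exists i.+1 => //; rewrite iterSr. Qed.

(** Frame condition: residue 1 modulo 3 is the class of the temporaries, so [M], the loop variables,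
    the cells and the pending operands all survive. *)
Definition scratch_from (t : nat) (m m' : nat -> nat) : Prop :=
  forall i, (i %% 3 != 1) || (i < tmp t) -> m' i = m i.

Definition env_agree (rho : seq nat) (m : nat -> nat) : Prop :=
  m 0 = M /\ forall i, i < size rho -> m (var i) = nth 0 rho i.

Lemma scratch_env t m m' rho :
  scratch_from t m m' -> env_agree rho m -> env_agree rho m'.
Proof.
by move=> fr [m0 mv]; split=> [|i ?]; rewrite fr ?m0 ?mv //; lia.
Qed.

Ltac upds := rewrite /= /upd; do ?[case: eqP => //; try lia].

(** The test comes after the addition, so the counter has to start positive; this is one use of
    [0 < M]. *)
Lemma scale_loop t o j m :
  code_at P o [:: Add (tmp t.+1) (tmp t.+1) (tmp t);
               Defs.Sub (tmp t.+2) (tmp t.+2) (tmp t.+3);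
               Jump (tmp t.+2) o] ->
  m (tmp t.+2) = j.+1 -> m (tmp t.+3) = 1 ->
  exists m', [/\ runs (3 * j.+1) (o, m) (o + 3, m'),
    m' (tmp t.+1) = m (tmp t.+1) + m (tmp t) * j.+1, m' (tmp t.+2) = 0
    & forall i, i != tmp t.+1 -> i != tmp t.+2 -> m' i = m i].
Proof.
move=> [i0 [i1 [i2 _]]].
elim: j m => [|j IH] m mj m1.
  exists (upd (upd m (tmp t.+1) (m (tmp t.+1) + m (tmp t))) (tmp t.+2) 0).
  split; last by move=> i; upds.
  - do 3!apply: runs_step; rewrite /step i0 i1.
    have -> : upd m (tmp t.+1) (m (tmp t.+1) + m (tmp t)) (tmp t.+2)
      - upd m (tmp t.+1) (m (tmp t.+1) + m (tmp t)) (tmp t.+3) = 0.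
      by upds.
    rewrite i2 {1}/upd eqxx addn3; exact: runs_refl.
  - by upds.
  - by upds.
pose m1' := upd (upd m (tmp t.+1) (m (tmp t.+1) + m (tmp t))) (tmp t.+2) j.+1.
have [||m' [run1 acc zero fr]] := IH m1'; try by rewrite /m1'; upds.
exists m'; split=> //.
- rewrite mulnS; do 3!apply: runs_step; rewrite /step i0 i1.
  have -> : upd m (tmp t.+1) (m (tmp t.+1) + m (tmp t)) (tmp t.+2)
      - upd m (tmp t.+1) (m (tmp t.+1) + m (tmp t)) (tmp t.+3) = j.+1.
      by upds.
  rewrite i2 {1}/upd eqxx /=; apply: runs_leq run1; lia.
- by rewrite acc /m1'; upds; rewrite (mulnS _ j.+1) addnA.
- move=> i ni1 ni2; rewrite fr // /m1' /upd (negbTE ni1) (negbTE ni2) //.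
Qed.

(** For binary operators the right operand is computed from [tmp t.+1] upwards, and the frame
    condition then keeps the left value in [tmp t]. *)
Lemma compile_exprP rho e o t m :
  code_at P o (compile_expr o t e) -> scoped_expr (size rho) e ->
  env_agree rho m ->
  exists m', [/\ runs (cost_expr M e) (o, m) (o + size (compile_expr o t e), m'),
    m' (tmp t) = eval inp M rho e & scratch_from t m m'].
Proof.
elim: e o t m => [c|i|a IHa b IHb|a IHa b IHb|a IHa|a IHa] o t m /=.
- move=> [i0 _] _ _; exists (upd m (tmp t) c); split.
  + apply: runs_step; rewrite /step i0; apply: runs_pc; lia.
  + by upds.
  + by move=> i; upds.
- move=> [i0 [i1 _]] lti [m0 mv].
  exists (upd (upd m (tmp t) 0) (tmp t) (m (var i))); split.
  + do 2!apply: runs_step; rewrite /step i0 i1.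
    have -> : upd m (tmp t) 0 (var i) + upd m (tmp t) 0 (tmp t) = m (var i).
      by upds.
    apply: runs_pc; lia.
  + by rewrite -mv //; upds.
  + by move=> j; upds.
- move=> /code_at_cat[ca /code_at_cat[cb /= [i0 _]]] /andP[sa sb] ag.
  have [m1 [run1 val1 fr1]] := IHa _ _ _ ca sa ag.
  have [m2 [run2 val2 fr2]] := IHb _ _ _ cb sb (scratch_env fr1 ag).
  exists (upd m2 (tmp t) (m2 (tmp t) + m2 (tmp t.+1))); split.
  + apply: runs_trans (runs_trans run1 run2) _.
    apply: runs_step; rewrite /step i0; apply: runs_pc.
    rewrite !size_cat /=; lia.
  + by rewrite -val1 -val2 -(fr2 (tmp t)); [upds | lia].
  + move=> i ci; rewrite -(fr1 i) // -(fr2 i); last lia.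
    by upds.
- move=> /code_at_cat[ca /code_at_cat[cb /= [i0 _]]] /andP[sa sb] ag.
  have [m1 [run1 val1 fr1]] := IHa _ _ _ ca sa ag.
  have [m2 [run2 val2 fr2]] := IHb _ _ _ cb sb (scratch_env fr1 ag).
  exists (upd m2 (tmp t) (m2 (tmp t) - m2 (tmp t.+1))); split.
  + apply: runs_trans (runs_trans run1 run2) _.
    apply: runs_step; rewrite /step i0; apply: runs_pc.
    rewrite !size_cat /=; lia.
  + by rewrite -val1 -val2 -(fr2 (tmp t)); [upds | lia].
  + move=> i ci; rewrite -(fr1 i) // -(fr2 i); last lia.
    by upds.
- move=> /code_at_cat[ca /= [i0 _]] sa ag.
  have [m1 [run1 val1 fr1]] := IHa _ _ _ ca sa ag.
  exists (upd m1 (tmp t) (nth 0 inp (m1 (tmp t)))); split.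
  + apply: runs_trans run1 _.
    apply: runs_step; rewrite /step i0; apply: runs_pc.
    rewrite size_cat /=; lia.
  + by rewrite -val1; upds.
  + by move=> i ci; rewrite -(fr1 i) //; upds.
- move=> /code_at_cat[ca /= [i0 [i1 [i2 [i3 [i4 [i5 [i6 _]]]]]]]] sa ag.
  have [m1 [run1 val1 fr1]] := IHa _ _ _ ca sa ag.
  have [m10 _] := scratch_env fr1 ag.
  pose m2 := upd (upd (upd m1 (tmp t.+1) 0) (tmp t.+2) M) (tmp t.+3) 1.
  have run2 : runs 3 (o + size (compile_expr o t a), m1)
                (o + size (compile_expr o t a) + 3, m2).
    do 3!apply: runs_step; rewrite /step i0 i1 i2.
    have -> : upd m1 (tmp t.+1) 0 0 + upd m1 (tmp t.+1) 0 (tmp t.+1) = M.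
      by upds.
    apply: runs_pc; lia.
  have [|||m3 [run3 acc zero fr3]] :=
      @scale_loop t (o + size (compile_expr o t a) + 3) M.-1 m2.
  + by rewrite [X in code_at P X _]addn3 /= i3 i4 i5.
  + by rewrite /m2; upds.
  + by rewrite /m2; upds.
  exists (upd m3 (tmp t) (m3 (tmp t.+1) + m3 (tmp t.+2))); split.
  + apply: runs_leq (runs_trans (runs_trans run1 run2)
      (runs_trans run3 (runs_step _))); last first.
      rewrite /step !addn3 i6 size_cat /=.
      have -> : (o + size (compile_expr o t a)).+4.+3
        = o + (size (compile_expr o t a) + 7) by lia.
      exact: runs_refl.
    by rewrite prednK //; lia.
  + rewrite acc zero prednK // /m2; upds; rewrite -val1; upds; lia.
  + move=> i ci; rewrite -(fr1 i) //.
    have -> : m1 i = m2 i by rewrite /m2; upds.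
    by rewrite -fr3; [upds | lia | lia].
Qed.

Definition agree (rho : seq nat) (h : pred nat) (m : nat -> nat) : Prop :=
  env_agree rho m /\ forall a, m (cell a) = h a.

Lemma agree_scratch rho h m m' :
  scratch_from 0 m m' -> agree rho h m -> agree rho h m'.
Proof.
move=> fr [ag mc]; split; first exact: scratch_env fr ag.
by move=> a; rewrite fr ?mc //; lia.
Qed.

Lemma compile_cellP rho e o m :
  code_at P o (compile_cell o e) -> scoped_expr (size rho) e ->
  env_agree rho m ->
  exists m', [/\
    runs (cost_expr M e + 4) (o, m) (o + size (compile_cell o e), m'),
    m' (tmp 1) = cell (eval inp M rho e) & scratch_from 0 m m'].
Proof.
move=> /code_at_cat[ca [i0 [i1 [i2 [i3 _]]]]] sa ag.
have [m1 [run1 val1 fr1]] := compile_exprP ca sa ag.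
set v := eval inp M rho e in val1 *.
exists (upd (upd m1 (tmp 1) (cell v)) (tmp 0) 2); split; last first.
- by move=> i ci; rewrite -(fr1 i) //; upds.
- by upds.
apply: runs_trans run1 _; do 4!apply: runs_step.
rewrite /step i0 i1 i2 i3 size_cat addnA addn4.
apply: runs_leq (leqnn 0) _.
set r := upd _ _ _; have -> : r = upd (upd m1 (tmp 1) (cell v)) (tmp 0) 2.
  by apply: funext => i; rewrite /r; upds.
exact: runs_refl.
Qed.

Lemma skip_if_zeroP rho h o target m :
  code_at P o (skip_if_zero target) -> agree rho h m ->
  exists2 m', runs 3 (o, m) (if 0 < m (tmp 0) then o + 3 else target, m')
    & agree rho h m'.
Proof.
move=> [i0 [i1 [i2 _]]] ag.
exists (upd (upd m (tmp 1) 1) (tmp 0) (1 - m (tmp 0))); last first.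
  by apply: agree_scratch ag => i; upds.
do 3!apply: runs_step; rewrite /step i0 i1.
have -> : upd m (tmp 1) 1 (tmp 1) - upd m (tmp 1) 1 (tmp 0) = 1 - m (tmp 0).
  by upds.
rewrite i2 {1}/upd eqxx addn3; case: (m (tmp 0)) => [|n] /=; exact: runs_refl.
Qed.

Lemma size_skip_if_zero target : size (skip_if_zero target) = 3.
Proof. by []. Qed.

Local Opaque skip_if_zero.

(** The depth of the enclosing loops is the length of [rho], so a new loop gets the fresh variable
    register [var (size rho)], which the body may read but leaves unchanged. *)
Lemma compileP rho s o h m :
  code_at P o (compile o (size rho) s) -> scoped (size rho) s ->
  agree rho h m ->
  exists2 m', runs (cost M s) (o, m) (o + size (compile o (size rho) s), m')
    & agree rho (exec inp M rho s h) m'.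
Proof.
elim: s rho o h m => [e|e s IH|e s IH|s IH|s1 IH1 s2 IH2] rho o h m /=.
- move=> /code_at_cat[ca [i0 [i1 _]]] sc ag.
  have [m1 [run1 val1 fr1]] := compile_cellP ca sc ag.1.
  have [[m10 m1v] m1c] := agree_scratch fr1 ag.
  exists (upd (upd m1 (tmp 0) 1) (cell (eval inp M rho e)) 1).
    apply: runs_leq (runs_trans run1 (runs_step (runs_step _))); last first.
      rewrite /step i0 i1 size_cat addnA /= addn2.
      have -> : upd m1 1 1 (tmp 1) = cell (eval inp M rho e) by rewrite -val1.
      exact: runs_refl.
    by lia.
  split; first by split=> [|i lti]; [upds | rewrite -m1v //; upds].
  move=> a; rewrite /upd; case: (a =P _) => [->|ne]; first by rewrite eqxx.
  by rewrite /= -m1c; case: eqP; [lia|]; case: eqP; [lia|].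
- move=> /code_at_cat[ca /code_at_cat[cs cb]] /andP[sc sb] ag.
  have [m1 [run1 val1 fr1]] := compile_exprP ca sc ag.1.
  have [m2 run2 ag2] := skip_if_zeroP cs (agree_scratch fr1 ag).
  have {}run1 := runs_trans run1 run2.
  move: run1; rewrite val1; case: ifP => _ run1.
    have [m3 run3 ag3] := IH _ _ _ _ cb sb ag2.
    exists m3 => //; rewrite !size_cat size_skip_if_zero !addnA.
    apply: runs_leq (runs_trans run1 run3); lia.
  exists m2 => //; rewrite !size_cat size_skip_if_zero !addnA; apply: runs_leq run1; lia.
- move=> /code_at_cat[ca /code_at_cons[i0 /code_at_cat[cs cb]]].
  move=> /andP[sc sb] ag.
  have [m1 [run1 val1 fr1]] := compile_cellP ca sc ag.1.
  have ag1 := agree_scratch fr1 ag.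
  set r := eval inp M rho e in val1 *.
  have ag1' : agree rho h (upd m1 (tmp 0) (h r)).
    by apply: agree_scratch ag1 => i; upds.
  have run1' : runs (cost_expr M e + 5) (o, m)
      ((o + size (compile_cell o e)).+1, upd m1 (tmp 0) (h r)).
    apply: runs_leq (runs_trans run1 (runs_step _)); last first.
      rewrite /step i0 val1 ag1.2; exact: runs_refl.
    lia.
  have [m2 run2 ag2] := skip_if_zeroP cs ag1'.
  have {}run1 := runs_trans run1' run2.
  move: run1; rewrite {1}/upd eqxx; case: (h r) => /= run1.
    have [|m3 run3 ag3] := IH _ (o + size (compile_cell o e) + 4) _ _ _ sb ag2.
      by move: cb; rewrite size_skip_if_zero; congr code_at; lia.
    exists m3 => //.
    apply: runs_leq (runs_trans run1 (runs_trans (runs_pc _ _)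
      (runs_trans run3 (runs_pc _ _)))); first lia.
      lia.
    rewrite size_cat /= size_cat size_skip_if_zero; lia.
  exists m2 => //; apply: runs_leq (runs_trans run1 (runs_pc _ _)).
    lia.
  rewrite size_cat /= size_cat size_skip_if_zero; lia.
- move=> /code_at_cons[i0 /code_at_cat[cb /= [i1 [i2 [i3 [i4 _]]]]]] sb ag.
  set d := size rho in i0 cb i1 i2 i3 i4 sb *.
  set e := o.+1 + size (compile o.+1 d.+1 s) in i1 i2 i3 i4 *.
  (* One round: the body, then four instructions that increment the loop variable and jump back
     exactly when [M - k.+1] is positive. *)
  have body k g m1 : k < M -> agree rho g m1 -> m1 (var d) = k ->
      exists2 m2, runs (cost M s + 4) (o.+1, m1)
                    (if 0 < M - k.+1 then o.+1 else e + 4, m2)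
        & agree rho (exec inp M (rcons rho k) s g) m2 /\ m2 (var d) = k.+1.
    move=> ltk [[m10 mv] mc] mk.
    have agk : agree (rcons rho k) g m1.
      split=> //; split=> // i; rewrite size_rcons nth_rcons ltnS leq_eqVlt.
      by move=> /orP[/eqP->|lti]; [rewrite ltnn eqxx | rewrite lti mv].
    have := IH (rcons rho k) o.+1 g m1.
    rewrite size_rcons => /(_ cb sb agk)[m2 run2 [[m20 m2v] m2c]].
    have m2k : m2 (var d) = k.
      by rewrite m2v ?size_rcons // nth_rcons ltnn eqxx.
    exists (upd (upd m2 (var d) k.+1) (tmp 0) (M - k.+1)).
      apply: runs_trans run2 _; do 4!apply: runs_step.
      rewrite /step i1 i2 i3 i4.
      set r := upd _ (tmp 0) _.
      have -> : r = upd (upd m2 (var d) k.+1) (tmp 0) (M - k.+1).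
        by apply: funext => i; rewrite /r; upds.
      rewrite {1}/upd eqxx addn4; exact: runs_refl.
    split; last by upds.
    split; last by move=> a; upds.
    split=> [|i lti]; first by upds.
    have -> : nth 0 rho i = m2 (var i).
      by rewrite m2v ?size_rcons ?nth_rcons ?lti // ltnS ltnW.
    by upds.
  (* Induction on the number [j.+1] of rounds left; at least one is left, as the test stands at the
     end of the loop. *)
  have loop j k g m1 : M = k + j.+1 -> agree rho g m1 -> m1 (var d) = k ->
      exists2 m2, runs (j.+1 * (cost M s + 4)) (o.+1, m1) (e + 4, m2)
        & agree rho (foldl (fun g k => exec inp M (rcons rho k) s g) g
                       (iota k j.+1)) m2.
    elim: j k g m1 => [|j IHj] k g m1 Mk agm mk.
      have [|m2] := body _ _ _ _ agm mk; first lia.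
      have -> : M - k.+1 = 0 by lia.
      by rewrite mul1n => run2 [ag2 _]; exists m2.
    have [|m2] := body _ _ _ _ agm mk; first lia.
    have -> : 0 < M - k.+1 by lia.
    move=> run2 [ag2 m2k].
    have [|m3 run3 ag3] := IHj k.+1 _ _ _ ag2 m2k; first lia.
    exists m3 => //; rewrite (mulSn j.+1); exact: runs_trans run2 run3.
  have [|||m2 run2 ag2] := loop M.-1 0 h (upd m (var d) 0).
  + by rewrite prednK.
  + case: ag => [[m0 mv] mc]; split; last by move=> a; upds.
    by split=> [|i lti]; [upds | rewrite -mv //; upds].
  + by upds.
  rewrite prednK // in run2 ag2; exists m2 => //.
  rewrite addn1; apply: runs_step; rewrite /step i0.
  have -> : o + (size (compile o.+1 d.+1 s ++ [:: Const (tmp 0) 1;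
      Add (var d) (var d) (tmp 0); Defs.Sub (tmp 0) 0 (var d);
      Jump (tmp 0) o.+1])).+1 = e + 4 by rewrite /e size_cat /=; lia.
  exact: run2.
- move=> /code_at_cat[c1 c2] /andP[sc1 sc2] ag.
  have [m1 run1 ag1] := IH1 _ _ _ _ c1 sc1 ag.
  have [m2 run2 ag2] := IH2 _ _ _ _ c2 sc2 ag1.
  exists m2 => //; rewrite size_cat addnA; exact: runs_trans run1 run2.
Qed.

End Simulation.

(** * Soundness and completeness of marking *)

(** A declarative reading of a statement: every test consults the fixed memory [h], and the order of
    execution disappears. Completeness ([fires_exec]) and soundness ([exec_invariant]) relate it to
    [exec]. *)
Fixpoint fires (inp : seq nat) (M : nat) (rho : seq nat) (s : stmt)
    (h : pred nat) (a : nat) : Prop :=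
  match s with
  | Mark e => a = eval inp M rho e
  | If e s' => 0 < eval inp M rho e /\ fires inp M rho s' h a
  | IfMarked e s' => h (eval inp M rho e) /\ fires inp M rho s' h a
  | For s' => exists2 k, k < M & fires inp M (rcons rho k) s' h a
  | Seq s1 s2 => fires inp M rho s1 h a \/ fires inp M rho s2 h a
  end.

Section Marking.

Variables (inp : seq nat) (M : nat).

Notation exec := (exec inp M).
Notation fires := (fires inp M).

Lemma subpred_exec rho s (h : pred nat) : subpred h (exec rho s h).
Proof.
elim: s rho h => [e|e s IH|e s IH|s IH|s1 IH1 s2 IH2] rho h a ha /=.
- by rewrite ha orbT.
- by case: ifP => // _; apply: IH.
- by case: ifP => // _; apply: IH.
- by elim: (iota 0 M) h ha => //= k ks IHk h ha; apply/IHk/IH.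
- by apply/IH2/IH1.
Qed.

Lemma fires_mono rho s (h h' : pred nat) a :
  subpred h h' -> fires rho s h a -> fires rho s h' a.
Proof.
move=> sub; elim: s rho => [e|e s IH|e s IH|s IH|s1 IH1 s2 IH2] rho //=.
- by case=> ? /IH.
- by case=> /sub ? /IH.
- by case=> k ltk /IH; exists k.
- by case=> [/IH1|/IH2]; [left|right].
Qed.

(** Memory only grows, so a test that succeeds in [h] still succeeds when it is reached, and no
    later statement removes the mark. *)
Lemma fires_exec rho s (h : pred nat) a : fires rho s h a -> exec rho s h a.
Proof.
elim: s rho h => [e|e s IH|e s IH|s IH|s1 IH1 s2 IH2] rho h /=.
- by move->; rewrite eqxx.
- by case=> -> /IH.
- by case=> -> /IH.
- case=> k; rewrite -[k < M](mem_iota 0 M).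
  elim: (iota 0 M) h => //= k' ks IHk h; rewrite inE => /orP[/eqP<-|kin] fi.
    (* The mark is made in the current round; the remaining rounds [ks] preserve it. *)
    by elim: ks (exec _ s h) (IH _ _ fi) {IHk} => //= k2 ks IHk g ga;
      apply/IHk/subpred_exec.
  by apply: (IHk _ kin); apply: fires_mono fi; apply: subpred_exec.
- case=> [/IH1|/(fires_mono (@subpred_exec rho s1 h))/IH2] //.
  exact: subpred_exec.
Qed.

(** The hypothesis concerns an arbitrary memory [g] inside [A], because the memory changes between
    the marks made by one execution of [s]. *)
Lemma exec_invariant (A : nat -> Prop) rho s (h : pred nat) :
  (forall (g : pred nat) a, (forall b, g b -> A b) -> fires rho s g a -> A a) ->
  (forall b, h b -> A b) -> forall b, exec rho s h b -> A b.
Proof.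
elim: s rho h => [e|e s IH|e s IH|s IH|s1 IH1 s2 IH2] rho h /= inv hA.
- by move=> b /orP[/eqP->|/hA//]; apply: (inv h).
- by case: ifP => // c; apply: IH => // g a gA fi; apply: (inv g).
- case: ifP => // c; apply: IH => // g a gA fi.
  (* The tested cell is marked in [h] but perhaps not in [g]; the union contains it and still lies
     inside [A]. *)
  pose g' b := g b || h b.
  apply: (inv g') => [b /orP[/gA|/hA]//|]; split; first by rewrite /g' c orbT.
  by apply: fires_mono fi => b gb; rewrite /g' gb.
- have : all (fun k => k < M) (iota 0 M).
    by apply/allP => k; rewrite mem_iota.
  elim: (iota 0 M) h hA => //= k ks IHk h hA /andP[ltk ltks].
  apply: IHk => //; apply: IH => // g a gA fi.
  by apply: (inv g) => //; exists k.
- apply: IH2 => [g a gA fi|]; first by apply: (inv g) => //; right.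
  by apply: IH1 => // g a gA fi; apply: (inv g) => //; left.
Qed.

(** [D i] stands for the progress guaranteed after [i] rounds; nesting the lemma three times gives
    [M ^ 3] rounds. *)
Lemma exec_for_count (D : nat -> pred nat -> Prop) m i rho s h :
  (forall k j g, D j g -> D (j + m) (exec (rcons rho k) s g)) ->
  D i h -> D (i + M * m) (exec rho (For s) h).
Proof.
move=> step /=; rewrite -{1}(size_iota 0 M).
elim: (iota 0 M) i h => [|k ks IH] i h /=; first by rewrite mul0n addn0.
by rewrite mulSn addnA => Dih; apply/IH/step.
Qed.

End Marking.

(** * The search program *)

(* Truth values are encoded as zero and positive. *)
Definition NotE e := Minus (Lit 1) e.
Definition LtE a b := Minus b a.
Definition NeqE a b := Plus (Minus a b) (Minus b a).
Definition EqE a b := NotE (NeqE a b).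

Definition InK1 := Input (Lit 0).
Definition InK2 := Input (Lit 1).
Definition InStates := Input (Lit 2).
Definition InEvents := Input (Lit 3).
Definition InInit := Input (Lit 5).
Definition InTrans := Input (Lit 6).
Definition InitAt i := Input (Plus (Lit 7) i).
Definition LabelAt t := Input (Plus (Plus (Lit 7) InInit) t).
Definition TransAt i j :=
  Input (Plus (Plus (Plus (Plus (Lit 7) InInit) InEvents)
           (Plus i (Plus i i))) (Lit j)).
Definition Src i := TransAt i 0.
Definition Lab i := LabelAt (TransAt i 1).
Definition Dst i := TransAt i 2.

Definition Top := Plus (Plus InK1 InK2) (Lit 1).
(** Both equality tests evaluate to 0 or 1, and at most one holds since [k1] is below the top level;
    subtracting them cancels the increment at the two saturation levels. *)
Definition Next c := Minus (Plus c (Lit 1)) (Plus (EqE c InK1) (EqE c Top)).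
(* The level is shifted by one so that cell 0 is free to hold the answer. *)
Definition Node c x y := Plus (Scale (Plus (Scale (Plus c (Lit 1))) x)) y.

Definition init_stmt :=
  For (For (If (LtE (Var 0) InInit) (If (LtE (Var 1) InInit)
    (Mark (Node (Lit 0) (InitAt (Var 0)) (InitAt (Var 1))))))).

(* The variables start at 3 because [move_stmt] is run below three loops whose
   only purpose is to repeat it [M ^ 3] times. *)
Definition sync_stmt :=
  let c := Var 3 in let e := Var 4 in let f := Var 5 in
  For (For (For
    (If (NotE (LtE Top c)) (If (LtE e InTrans) (If (LtE f InTrans)
    (If (Lab e) (If (EqE (Lab e) (Lab f))
    (IfMarked (Node c (Src e) (Src f))
      (Mark (Node (Next c) (Dst e) (Dst f))))))))))).

Definition left_stmt :=
  let c := Var 3 in let e := Var 4 in let y := Var 5 in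
  For (For (For
    (If (NotE (LtE Top c)) (If (LtE e InTrans) (If (LtE y InStates)
    (If (NotE (Lab e))
    (IfMarked (Node c (Src e) y) (Mark (Node c (Dst e) y))))))))).

Definition right_stmt :=
  let c := Var 3 in let e := Var 4 in let x := Var 5 in
  For (For (For
    (If (NotE (LtE Top c)) (If (LtE e InTrans) (If (LtE x InStates)
    (If (NotE (Lab e))
    (IfMarked (Node c x (Src e)) (Mark (Node c x (Dst e)))))))))).

Definition switch_stmt :=
  let x := Var 3 in let y := Var 4 in
  For (For (If (LtE x InStates) (If (LtE y InStates) (If (NeqE x y)
    (IfMarked (Node InK1 x y) (Mark (Node (Plus InK1 (Lit 1)) x y))))))).

Definition move_stmt :=
  Seq (Seq sync_stmt switch_stmt) (Seq left_stmt right_stmt).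

Definition final_stmt :=
  For (For (If (LtE (Var 0) InStates) (If (LtE (Var 1) InStates)
    (IfMarked (Node Top (Var 0) (Var 1)) (Mark (Lit 0)))))).

Definition search_stmt :=
  Seq init_stmt (Seq (For (For (For move_stmt))) final_stmt).

(** * The input and the graph of pairs *)

Section Encoding.

Variable S : fsa.
Variables k1 k2 : nat.

Lemma rank_inj (T : finType) : injective (@rank T).
Proof. by move=> x y /ord_inj/enum_rank_inj. Qed.

Lemma rank_lt (T : finType) (x : T) : rank x < #|T|.
Proof. exact: ltn_ord. Qed.

Lemma rank_surj (T : finType) i : i < #|T| -> exists x : T, rank x = i.
Proof. by move=> lti; exists (enum_val (Ordinal lti)); rewrite /rank enum_valK. Qed.

Lemma nth_rank (T : finType) (x0 x : T) : nth x0 (enum T) (rank x) = x.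
Proof. exact: nth_enum_rank. Qed.

Definition inp : seq nat := encode S k1 k2.

Lemma header :
  [/\ nth 0 inp 0 = k1, nth 0 inp 1 = k2, nth 0 inp 2 = #|state S|,
      nth 0 inp 3 = #|event S| & [/\ nth 0 inp 4 = #|symbol S|,
      nth 0 inp 5 = #|init S| & nth 0 inp 6 = #|trans S|]].
Proof. by []. Qed.

Lemma nth_init i : i < #|init S| ->
  nth 0 inp (7 + i) = nth 0 [seq rank x | x <- enum (init S)] i.
Proof. by move=> lti; rewrite /inp /encode /= nth_cat size_map -cardE lti. Qed.

Lemma init_at i : i < #|init S| ->
  exists2 x, x \in init S & nth 0 inp (7 + i) = rank x.
Proof.
move=> lti; rewrite nth_init //; rewrite cardE in lti.
have x0 : state S by case: (enum (init S)) lti.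
by exists (nth x0 (enum (init S)) i); rewrite ?(nth_map x0) // -mem_enum mem_nth.
Qed.

Lemma init_index x : x \in init S ->
  exists2 i, i < #|init S| & nth 0 inp (7 + i) = rank x.
Proof.
move=> xi; have lti : index x (enum (init S)) < #|init S|.
  by rewrite cardE index_mem mem_enum.
exists (index x (enum (init S))) => //.
by rewrite nth_init // (nth_map x) ?nth_index ?mem_enum // -cardE.
Qed.

Lemma label_at (t : event S) : nth 0 inp (7 + #|init S| + rank t) = code_label t.
Proof.
rewrite /inp /encode -addnA /= nth_cat size_map -cardE ltnNge leq_addr /=.
rewrite add0n addKn nth_cat size_map -cardE rank_lt.
by rewrite (nth_map t) -?cardE ?rank_lt // nth_rank.
Qed.

Lemma nth_trans e0 i j : i < #|trans S| -> j < 3 ->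
  nth 0 inp (7 + #|init S| + #|event S| + (i + (i + i)) + j) =
  nth 0 (code_trans (nth e0 (enum (trans S)) i)) j.
Proof.
move=> lti ltj; rewrite /inp /encode -!addnA /= nth_cat size_map -cardE.
rewrite ltnNge leq_addr /= add0n addKn nth_cat size_map -cardE ltnNge leq_addr /= addKn.
rewrite cardE in lti.
elim: (enum (trans S)) i lti => //= [[[x t] y]] l IH [_|i lti].
  by case: j ltj {IH} => [|[|[|]]].
rewrite [RHS]/= -IH //; have -> : i.+1 + (i.+1 + (i.+1 + j)) = (i + (i + (i + j))).+3 by lia.
by [].
Qed.

Definition src_at i := nth 0 inp (7 + #|init S| + #|event S| + (i + (i + i)) + 0).
Definition lab_at i :=
  nth 0 inp (7 + #|init S| +
    nth 0 inp (7 + #|init S| + #|event S| + (i + (i + i)) + 1)).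
Definition dst_at i := nth 0 inp (7 + #|init S| + #|event S| + (i + (i + i)) + 2).

Lemma trans_at i : i < #|trans S| -> exists x t y, [/\ (x, t, y) \in trans S,
  src_at i = rank x, lab_at i = code_label t & dst_at i = rank y].
Proof.
move=> lti; rewrite /src_at /lab_at /dst_at.
have e0 : state S * event S * state S.
  by move: lti; rewrite cardE; case: (enum (trans S)).
rewrite !(nth_trans e0) //.
have : nth e0 (enum (trans S)) i \in trans S by rewrite -mem_enum mem_nth -?cardE.
case: (nth _ _ _) => [[x t] y] xty; exists x, t, y; split=> //=.
exact: label_at.
Qed.

Lemma trans_index x t y : (x, t, y) \in trans S -> exists2 i, i < #|trans S|
  & [/\ src_at i = rank x, lab_at i = code_label t & dst_at i = rank y].
Proof.
move=> xty; have lti : index (x, t, y) (enum (trans S)) < #|trans S|.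
  by rewrite cardE index_mem mem_enum.
exists (index (x, t, y) (enum (trans S))) => //.
rewrite /src_at /lab_at /dst_at !(nth_trans (x, t, y)) // nth_index ?mem_enum //=.
by split=> //; exact: label_at.
Qed.

Lemma code_label_eq (t u : event S) :
  (code_label t == code_label u) = (label t == label u).
Proof.
rewrite /code_label; case: (label t) (label u) => [a|] [b|] //=.
by rewrite eqSS (inj_eq (@rank_inj _)).
Qed.

Lemma code_label_gt0 (t : event S) : (0 < code_label t) = (label t != None).
Proof. by rewrite /code_label; case: (label t). Qed.

(** * Pairs of runs as paths, and detectability *)

Definition top := k1 + k2 + 1.

Definition next c := if (c == k1) || (c == top) then c else c.+1.

Definition node : finType := ('I_top.+1 * state S * state S)%type.

Definition next_ord (c : 'I_top.+1) : 'I_top.+1 := inord (next c).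

(** Observable events are taken jointly and silent ones separately. As [next] stops at [k1], level
    [k1.+1] can be entered from [k1] only through [MoveSwitch], which checks that the states
    differ. *)
Inductive move : node -> node -> Prop :=
| MoveSync c t u x y x' y' of (x, t, x') \in trans S & (y, u, y') \in trans S
    & label t = label u & label t <> None : move (c, x, y) (next_ord c, x', y')
| MoveLeft c t x y x' of (x, t, x') \in trans S & label t = None :
    move (c, x, y) (c, x', y)
| MoveRight c t x y y' of (y, t, y') \in trans S & label t = None :
    move (c, x, y) (c, x, y')
| MoveSwitch x y of x <> y : move (inord k1, x, y) (inord k1.+1, x, y).

Definition moveb : rel node := fun u v => `[< move u v >].

Lemma val_next_ord c : next_ord c = next c :> nat.
Proof.
rewrite inordK // /next; case: ifP => // /negbT/norP[_ /eqP].
by have := ltn_ord c; lia.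
Qed.

Definition reach (u : node) : Prop := exists x0 y0,
  [/\ x0 \in init S, y0 \in init S & connect moveb (ord0, x0, y0) u].

Definition joint_run (w : seq (symbol S)) (x y x' y' : state S) : Prop :=
  exists s u, [/\ run x s x', run y u y', label_word s = w & label_word u = w].

Lemma run_cat (x y z : state S) s u : run x s y -> run y u z -> run x (s ++ u) z.
Proof.
elim: s x => [|t s IH] x /=; first by move->.
by case=> x' xt r1 r2; exists x' => //; apply: IH.
Qed.

Lemma joint_run_cat w w' x y x' y' x2 y2 :
  joint_run w x y x' y' -> joint_run w' x' y' x2 y2 ->
  joint_run (w ++ w') x y x2 y2.
Proof.
move=> [s [u [r1 r2 ls lu]]] [s' [u' [r1' r2' ls' lu']]].
exists (s ++ s'), (u ++ u'); rewrite /label_word !pmap_cat.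
by split; [exact: run_cat r1 r1'|exact: run_cat r2 r2'|congr cat|congr cat].
Qed.

(** The two runs are interleaved: silent events are consumed one side at a time until both runs face
    their next observable event, whose labels agree. *)
Lemma connect_iter_next w x y x' y' c : joint_run w x y x' y' ->
  connect moveb (c, x, y) (iter (size w) next_ord c, x', y').
Proof.
move=> [s [u [rs ru <- e]]]; elim: s u x y c rs ru e => [|t s IHs] u x y c /=.
  move=> <-{x'}; elim: u y => [|t u IHu] y /=; first by move->; rewrite connect0.
  case=> y1 yt ru; case lt: (label t) => [b|] //= e.
  apply: connect_trans (connect1 _) (IHu _ ru e).
  by apply/asboolP; apply: MoveRight yt lt.
case=> x1 xt rs ru; case lt: (label t) => [b|] /= e; last first.
  apply: connect_trans (connect1 _) (IHs _ _ _ _ rs ru e).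
  by apply/asboolP; apply: MoveLeft xt lt.
(* The left run waits at an observable event while the inner induction consumes the silent events of
   the right one. *)
elim: u y ru e => [|t' u IHu] y //= [y1 yt ru]; case lt': (label t') => [b'|] /= e.
  case: e => eb e; rewrite -iterS iterSr.
  apply: connect_trans (connect1 _) (IHs _ _ _ _ rs ru e).
  by apply/asboolP; apply: MoveSync xt yt _ _; rewrite lt ?lt' ?eb.
apply: connect_trans (connect1 _) (IHu _ ru e).
by apply/asboolP; apply: MoveRight yt lt'.
Qed.

Lemma iter_next_first j : k1 <= j -> iter j next_ord ord0 = inord k1.
Proof.
move=> lekj; apply: ord_inj; rewrite inordK; last by rewrite /top; lia.
(* Generalised for the induction: after [j] observations the level is [minn j k1]. *)
rewrite -(minn_idPr lekj); elim: j {lekj} => [|j IH] /=; first by rewrite min0n.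
by rewrite val_next_ord IH /next /top; do !case: eqP => //=; lia.
Qed.

Lemma iter_next_second j : k2 <= j -> iter j next_ord (inord k1.+1) = inord top.
Proof.
move=> lekj; apply: ord_inj; rewrite [RHS]inordK //.
transitivity (minn (k1.+1 + j) top); last by rewrite /top; lia.
elim: j {lekj} => [|j IH] /=; first by rewrite inordK /top; lia.
by rewrite val_next_ord IH /next /top; do !case: eqP => //=; lia.
Qed.

Definition ambiguous : Prop := exists x0 y0 x y x' y' w1 w2,
  [/\ x0 \in init S, y0 \in init S, x <> y, k1 <= size w1 & k2 <= size w2] /\
  joint_run w1 x0 y0 x y /\ joint_run w2 x y x' y'.

(** The invariant of a path splits at the switch. A level is only a lower bound on the number of
    observations of its phase, because levels saturate. *)
Definition first_phase (c : nat) (x y : state S) : Prop := exists x0 y0 w,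
  [/\ x0 \in init S, y0 \in init S, c <= size w & joint_run w x0 y0 x y].

Definition second_phase (c : nat) (x y : state S) : Prop := exists x1 y1 w,
  [/\ x1 <> y1, first_phase k1 x1 y1, c <= k1.+1 + size w
    & joint_run w x1 y1 x y].

Definition phase (u : node) : Prop :=
  let: (c, x, y) := u in
  if c <= k1 then first_phase c x y else second_phase c x y.

(** Covers all moves but the switch: they stay within one phase and append to its joint run. *)
Lemma phase_joint (c c' : 'I_top.+1) x y x' y' w :
  joint_run w x y x' y' -> (c <= k1) = (c' <= k1) -> c' <= c + size w ->
  phase (c, x, y) -> phase (c', x', y').
Proof.
move=> xy ec lec; rewrite /phase -ec; case: ifP => _.
  move=> [x0 [y0 [w0 [xi yi le0 xy0]]]]; exists x0, y0, (w0 ++ w); split=> //.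
    by rewrite size_cat; lia.
  exact: joint_run_cat xy0 xy.
move=> [x1 [y1 [w0 [ne fp le0 xy0]]]]; exists x1, y1, (w0 ++ w); split=> //.
  by rewrite size_cat; lia.
exact: joint_run_cat xy0 xy.
Qed.

Lemma phase_move u v : move u v -> phase u -> phase v.
Proof.
case=> [c t u' x y x' y' xt yu tu tN | c t x y x' xt tN | c t x y y' yt tN
      | x y xy].
- case lt: (label t) tN tu => [b|] // _ lu; apply: (@phase_joint _ _ _ _ _ _ [:: b]).
  + exists [:: t], [:: u'] => /=; split; [by exists x' | by exists y' | |].
    * by rewrite lt.
    * by rewrite -lu.
  + by rewrite val_next_ord /next /top; do !case: eqP => //=; lia.
  + by rewrite val_next_ord /next /=; case: ifP => _; lia.
- apply: (@phase_joint _ _ _ _ _ _ [::]); rewrite ?addn0 //.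
  by exists [:: t], [::] => /=; split=> //; [exists x' | rewrite tN].
- apply: (@phase_joint _ _ _ _ _ _ [::]); rewrite ?addn0 //.
  by exists [::], [:: t] => /=; split=> //; [exists y' | rewrite tN].
- rewrite /phase !inordK; try by rewrite /top; lia.
  rewrite leqnn ltnn => fp; exists x, y, [::]; split=> //; first by rewrite addn0.
  by exists [::], [::].
Qed.

(** Forwards, the invariant [phase] is carried along the path; backwards, the paths of the two joint
    runs are glued together by a switch. *)
Lemma reach_ambiguous : (exists x y, reach (inord top, x, y)) <-> ambiguous.
Proof.
split.
  move=> [x [y [x0 [y0 [xi yi /connectP[p pP e]]]]]].
  have : phase (ord0, x0, y0).
    by exists x0, y0, [::]; split=> //; exists [::], [::].
  have {xi yi} : phase (ord0, x0, y0) -> phase (inord top, x, y).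
    rewrite e; elim: p (ord0, x0, y0) pP {e} => //= v p IH u /andP[/asboolP uv pP].
    by move=> /(phase_move uv)/(IH _ pP).
  move=> imp /imp; rewrite /phase inordK // ifF; last by rewrite /top; lia.
  move=> [x1 [y1 [w2 [ne [a [b [w1 [ai bi le1 r1]]]] le2 r2]]]].
  exists a, b, x1, y1, x, y, w1, w2; do !split=> //.
  by move: le2; rewrite /top; lia.
move=> [x0 [y0 [x [y [x' [y' [w1 [w2 [[xi yi ne le1 le2] [r1 r2]]]]]]]]]].
exists x', y', x0, y0; split=> //.
have := connect_iter_next ord0 r1; rewrite iter_next_first // => r.
apply: connect_trans r _.
apply: (@connect_trans _ _ (inord k1.+1, x, y)).
  by apply: connect1; apply/asboolP; apply: MoveSwitch.
by have := connect_iter_next (inord k1.+1) r2; rewrite iter_next_second.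
Qed.

Lemma run_split (x x' : state S) s w1 w2 : run x s x' -> label_word s = w1 ++ w2 ->
  exists y s1 s2, [/\ run x s1 y, run y s2 x', label_word s1 = w1
                    & label_word s2 = w2].
Proof.
elim: s x w1 => [|t s IH] x w1 /=.
  by move=> <-; case: w1 => //= <-; exists x, [::], [::].
case=> x1 xt r; case lt: (label t) => [b|] /= e.
  case: w1 e => [|b1 w1] /= e.
    exists x, [::], (t :: s); split=> //=; first by exists x1.
    by rewrite lt.
  case: e => eb e; have [y [s1 [s2 [r1 r2 l1 l2]]]] := IH _ _ r e.
  exists y, (t :: s1), s2; split=> //=; first by exists x1.
  by rewrite lt /= eb -l1.
have [y [s1 [s2 [r1 r2 l1 l2]]]] := IH _ _ r e.
exists y, (t :: s1), s2; split=> //=; first by exists x1.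
by rewrite lt.
Qed.

(** For a prefix of a word of the language the estimate is never empty, since a run can be cut after
    [w1]. Detectability therefore fails only through two distinct elements, that is, two joint
    runs. *)
Lemma detectableP : detectable S k1 k2 <-> ~ ambiguous.
Proof.
split.
  move=> det [x0 [y0 [x [y [x' [y' [w1 [w2 [[xi yi ne le1 le2]]]]]]]]]].
  move=> [[s1 [u1 [rs1 ru1 ls1 lu1]]] [s2 [u2 [rs2 ru2 ls2 lu2]]]].
  have lang : language (w1 ++ w2).
    exists x0, x', (s1 ++ s2); split=> //; first exact: run_cat rs1 rs2.
    by rewrite /label_word pmap_cat; congr cat.
  have /eqP/cards1P[z ez] := det _ _ _ lang (prefix_refl _) le1 le2.
  have : x \in delayed_estimate w1 w2.
    by rewrite inE; apply/asboolP; exists x0, x', s1, s2; split.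
  have : y \in delayed_estimate w1 w2.
    by rewrite inE; apply/asboolP; exists y0, y', u1, u2; split.
  by rewrite ez !inE => /eqP yz /eqP xz; case: ne; rewrite xz yz.
move=> namb w w1 w2 [x0 [x [s [xi r ls]]]] /prefixP[w3 ew] le1 le2.
have [y [s12 [s3 [r12 _ l12 _]]]] : exists y s1 s2,
    [/\ run x0 s1 y, run y s2 x, label_word s1 = w1 ++ w2 & label_word s2 = w3].
  by apply: run_split r _; rewrite ls ew.
have [z [s1 [s2 [r1 r2 l1 l2]]]] := run_split r12 l12.
apply/eqP; rewrite eqn_leq andbC; apply/andP; split.
  apply/card_gt0P; exists z; rewrite inE; apply/asboolP.
  by exists x0, y, s1, s2; split.
rewrite leqNgt; apply/card_gt1P => -[a [b []]]; rewrite !inE.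
move=> /asboolP[a0 [a' [sa1 [sa2 [ai la1 la2 ra1 ra2]]]]].
move=> /asboolP[b0 [b' [sb1 [sb2 [bi lb1 lb2 rb1 rb2]]]]] /eqP ne.
apply: namb; exists a0, b0, a, b, a', b', w1, w2; split=> //.
by split; [exists sa1, sb1 | exists sa2, sb2].
Qed.

(** * Correctness of the search program *)

Variable M : nat.
Hypothesis M_states : #|state S| <= M.
Hypothesis M_trans : #|trans S| <= M.
Hypothesis M_top : top < M.

Definition node_cell (u : node) : nat :=
  let: (c, x, y) := u in ((c + 1) * M + rank x) * M + rank y.

Lemma init_le_M : #|init S| <= M.
Proof. by apply: leq_trans M_states; apply: max_card. Qed.

Lemma rank_ltM (x : state S) : rank x < M.
Proof. exact: leq_trans (rank_lt x) M_states. Qed.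

Lemma node_cell_gt0 u : 0 < node_cell u.
Proof.
have M_gt0 : 0 < M by apply: leq_ltn_trans M_top.
by case: u => [[c x] y]; rewrite /node_cell addn_gt0 muln_gt0 addn_gt0 muln_gt0 M_gt0 addn1.
Qed.

(** The cell number is read in base [M]: the ranks are proper digits, and the leading part needs no
    bound. *)
Lemma node_cell_inj : injective node_cell.
Proof.
have pair_inj a b a' b' : b < M -> b' < M -> a * M + b = a' * M + b' ->
    a = a' /\ b = b'.
  move=> ltb ltb' e; split.
    have := congr1 (divn^~ M) e.
    by rewrite /= !divnMDl ?divn_small ?addn0 //; apply: leq_ltn_trans ltb.
  by have := congr1 (modn^~ M) e; rewrite /= !modnMDl !modn_small.
case=> [[c x] y] [[c' x'] y'] /pair_inj[]; try exact: rank_ltM.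
move=> /pair_inj[]; try exact: rank_ltM.
by move=> /addIn/ord_inj-> /rank_inj-> /rank_inj->.
Qed.

Local Opaque inp.

(** The left side is the shape to which [Next] evaluates on the encoded input. *)
Lemma next_eval c :
  c + 1 - (1 - (c - k1 + (k1 - c)) + (1 - (c - top + (top - c)))) = next c.
Proof. by rewrite /next /top; case: eqP; case: eqP => /=; lia. Qed.

(** Each of the four statements mirrors one constructor of [move]; the guards ensure that loop
    indices denote actual levels, transitions and states. *)
Lemma fires_move rho h a : size rho = 3 -> fires inp M rho move_stmt h a ->
  exists u v, [/\ move u v, h (node_cell u) & a = node_cell v].
Proof.
have [h0 h1 h2 h3 [h4 h5 h6]] := header.
move: rho => [|r0 [|r1 [|r2 []]]] // _ /=.
rewrite h0 h1 h2 h3 h5 h6 -!/top.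
case=> [[[c _ [e _ [f _]]] | [i _ [j _]]] | [[c _ [e _ [i _]]] | [c _ [e _ [i _]]]]].
- rewrite -/(lab_at e) -/(lab_at f) -/(src_at e) -/(src_at f).
  rewrite -/(dst_at e) -/(dst_at f) !subn_gt0 next_eval.
  move=> [ltc [lte [ltf [lab0 [labE [hc ->]]]]]].
  have {}ltc : c < top.+1 by lia.
  have [x [t [x' [xt sx lt dx]]]] := trans_at lte.
  have [y [u [y' [yu sy lu dy]]]] := trans_at ltf.
  rewrite sx sy in hc; rewrite lt lu in labE; rewrite lt code_label_gt0 in lab0.
  exists (Ordinal ltc, x, y), (next_ord (Ordinal ltc), x', y'); split=> //.
    apply: (MoveSync _ xt yu); last by apply/eqP.
    by apply/eqP; rewrite -code_label_eq; lia.
  by rewrite /node_cell val_next_ord dx dy.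
- rewrite !subn_gt0 => [[/rank_surj[x <-] [/rank_surj[y <-] [ne [hc ->]]]]].
  exists (inord k1, x, y), (inord k1.+1, x, y); split.
  + by apply: MoveSwitch => xy; rewrite xy in ne; lia.
  + by rewrite /node_cell inordK // /top; lia.
  + by rewrite /node_cell inordK ?addn1 // /top; lia.
- rewrite -/(lab_at e) -/(src_at e) -/(dst_at e) !(subn_gt0 _ #|_|).
  move=> [ltc [lte [/rank_surj[y <-] [lab0 [hc ->]]]]].
  have {}ltc : c < top.+1 by lia.
  have [x [t [x' [xt sx lt dx]]]] := trans_at lte.
  exists (Ordinal ltc, x, y), (Ordinal ltc, x', y); split.
  + apply: (MoveLeft _ _ xt); apply/eqP; rewrite -[_ == _]negbK -code_label_gt0.
    by rewrite -lt; lia.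
  + by rewrite /node_cell -sx.
  + by rewrite /node_cell -dx.
- rewrite -/(lab_at e) -/(src_at e) -/(dst_at e) !(subn_gt0 _ #|_|).
  move=> [ltc [lte [/rank_surj[x <-] [lab0 [hc ->]]]]].
  have {}ltc : c < top.+1 by lia.
  have [y [t [y' [yt sy lt dy]]]] := trans_at lte.
  exists (Ordinal ltc, x, y), (Ordinal ltc, x, y'); split.
  + apply: (MoveRight _ _ yt); apply/eqP; rewrite -[_ == _]negbK -code_label_gt0.
    by rewrite -lt; lia.
  + by rewrite /node_cell -sy.
  + by rewrite /node_cell -dy.
Qed.

Lemma move_fires rho (h : pred nat) u v : size rho = 3 -> move u v ->
  h (node_cell u) -> fires inp M rho move_stmt h (node_cell v).
Proof.
have [h0 h1 h2 h3 [h4 h5 h6]] := header.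
move: rho => [|r0 [|r1 [|r2 []]]] // _ /=.
rewrite h0 h1 h2 h3 h5 h6 -!/top.
case=> [c t u' x y x' y' xt yu tu tN | c t x y x' xt tN | c t x y y' yt tN
      | x y xy] hc.
- left; left; have ltc : c < top.+1 := ltn_ord c.
  have [e lte [sx lt dx]] := trans_index xt.
  have [f ltf [sy lu dy]] := trans_index yu.
  exists c; first lia; exists e; first exact: leq_trans M_trans.
  exists f; first exact: leq_trans M_trans.
  rewrite -/(lab_at e) -/(lab_at f) -/(src_at e) -/(src_at f).
  rewrite -/(dst_at e) -/(dst_at f) !(subn_gt0 _ #|_|) next_eval.
  have eq_lab : code_label t = code_label u'.
    by apply/eqP; rewrite code_label_eq tu.
  rewrite lte ltf lt lu sx sy dx dy code_label_gt0; do !split=> //.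
  + by lia.
  + by apply/eqP.
  + by rewrite eq_lab; lia.
  + by rewrite /node_cell val_next_ord.
- right; left; have ltc : c < top.+1 := ltn_ord c.
  have [e lte [sx lt dx]] := trans_index xt.
  exists c; first lia; exists e; first exact: leq_trans M_trans.
  exists (rank y); first exact: rank_ltM.
  rewrite -/(lab_at e) -/(src_at e) -/(dst_at e) !(subn_gt0 _ #|_|).
  rewrite lte rank_lt lt sx dx /code_label tN; do !split=> //; lia.
- right; right; have ltc : c < top.+1 := ltn_ord c.
  have [e lte [sy lt dy]] := trans_index yt.
  exists c; first lia; exists e; first exact: leq_trans M_trans.
  exists (rank x); first exact: rank_ltM.
  rewrite -/(lab_at e) -/(src_at e) -/(dst_at e) !(subn_gt0 _ #|_|).
  rewrite lte rank_lt lt sy dy /code_label tN; do !split=> //; lia.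
- left; right; exists (rank x); first exact: rank_ltM.
  exists (rank y); first exact: rank_ltM.
  rewrite !(subn_gt0 _ #|_|) !rank_lt; do !split=> //.
  + have : rank x <> rank y by move/rank_inj.
    by lia.
  + by move: hc; rewrite /node_cell inordK // /top; lia.
  + by rewrite /node_cell inordK ?addn1 // /top; lia.
Qed.

(** Soundness is an invariant on the marked cells; completeness counts rounds against the length of
    a path without repetitions. *)
Lemma search_stmtP :
  exec inp M [::] search_stmt pred0 0 <->
  exists x y : state S, reach (inord top, x, y).
Proof.
have [h0 h1 h2 h3 [h4 h5 h6]] := header.
split.
  (* Node cells are positive, so cell 0 can satisfy [A] only through the first alternative. *)
  pose A b := (b = 0 /\ exists x y : state S, reach (inord top, x, y))
    \/ exists2 u, reach u & b = node_cell u.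
  move=> ex; suff: A 0.
    case=> [[]//|[u _ u0]]; by have := node_cell_gt0 u; rewrite -u0.
  have A_inv (g : pred nat) a : (forall b, g b -> A b) ->
      fires inp M [::] search_stmt g a -> A a.
    move=> gA [fi|[[a1 _ [a2 _ [a3 _ fi]]]|fi]].
    - case: fi => i _ [j _] /=; rewrite h5 !subn_gt0 => [[lti [ltj ->]]].
      have [x xi ->] := init_at lti; have [y yi ->] := init_at ltj.
      right; exists (ord0, x, y) => //; exists x, y; split=> //.
    - have [|u [v [uv gu ->]]] := fires_move _ fi; first by [].
      case: (gA _ gu) => [[u0]|[u' [x0 [y0 [xi yi u'P]]] /node_cell_inj e]].
        by have := node_cell_gt0 u; rewrite u0.
      right; exists v => //; exists x0, y0; split=> //.
      by rewrite -e in u'P; apply: connect_trans u'P (connect1 _); apply/asboolP.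
    - case: fi => i _ [j _] /=; rewrite h0 h1 h2 !subn_gt0 -!/top.
      move=> [/rank_surj[x <-] [/rank_surj[y <-] [hg ->]]]; left; split=> //.
      have cE : node_cell (inord top, x, y) = ((top + 1) * M + rank x) * M + rank y.
        by rewrite /node_cell inordK.
      rewrite -cE in hg; exists x, y.
      case: (gA _ hg) => [[u0]|[u' ru' /node_cell_inj->//]].
      by have := node_cell_gt0 (inord top, x, y); rewrite u0.
  by apply: (exec_invariant A_inv _ ex).
case=> x [y [x0 [y0 [xi yi /connectP[p0 p0P]]]]].
case/shortenP: p0P => p pP p_uniq _ e.
(* All nodes within distance [i] of the chosen initial pair are marked; each round extends the
   distance by one. *)
pose D i (h : pred nat) := forall q, path moveb (ord0, x0, y0) q -> size q <= i ->
  h (node_cell (last (ord0, x0, y0) q)).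
have D0 : D 0 (exec inp M [::] init_stmt pred0).
  move=> [|//] _ _; apply: fires_exec.
  have [i lti ix] := init_index xi; have [j ltj jy] := init_index yi.
  exists i; first exact: leq_trans init_le_M.
  exists j; first exact: leq_trans init_le_M.
  by rewrite /= h5 ix jy !subn_gt0.
have D_step rho j g : size rho = 3 -> D j g -> D (j + 1) (exec inp M rho move_stmt g).
  move=> rho3 Dg q; case/lastP: q => [|q v].
    by move=> _ _; apply/subpred_exec/(Dg [::]).
  rewrite rcons_path size_rcons last_rcons addn1 ltnS => /andP[qP /asboolP uv] leq.
  by apply: fires_exec; apply: move_fires uv _ => //; apply: Dg.
have D_loop : D (0 + M * (M * (M * 1)))
    (exec inp M [::] (For (For (For move_stmt))) (exec inp M [::] init_stmt pred0)).
  apply: exec_for_count D0 => a1 j1 g1; apply: exec_for_count => a2 j2 g2.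
  by apply: exec_for_count => a3 j3 g3; apply: D_step.
apply: (fires_exec (s := final_stmt)); exists (rank x); first exact: rank_ltM.
exists (rank y); first exact: rank_ltM.
rewrite /= h0 h1 h2 !subn_gt0 !rank_lt -!/top; split=> //; split=> //; split=> //.
have <- : node_cell (inord top, x, y) = ((top + 1) * M + rank x) * M + rank y.
  by rewrite /node_cell inordK.
rewrite e; apply: D_loop => //.
(* The path has no repeated node, so its length is below [top.+1 * #|state S| * #|state S|], hence
   at most [M ^ 3]. *)
have := max_card (mem ((ord0, x0, y0) :: p)); rewrite (card_uniqP p_uniq) /=.
rewrite !card_prod card_ord muln1 add0n => lt_p.
apply: leq_trans (ltnW lt_p) _; rewrite -mulnA; apply: leq_mul => //.
exact: leq_mul.
Qed.

End Encoding.

(** * The machine program *)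

Lemma cost_expr_poly e :
  exists p : {poly nat}, forall M, p.[M]%R = cost_expr M e.
Proof.
elim: e => [c|i|a [p IHa] b [q IHb]|a [p IHa] b [q IHb]|a [p IHa]|a [p IHa]].
- by exists (polyC 1) => M; rewrite hornerC.
- by exists (polyC 2) => M; rewrite hornerC.
- by exists (p + q + polyC 1)%R => M;
  rewrite !(hornerD, hornerM, hornerC, hornerX) IHa IHb.
- by exists (p + q + polyC 1)%R => M;
  rewrite !(hornerD, hornerM, hornerC, hornerX) IHa IHb.
- by exists (p + polyC 1)%R => M;
  rewrite !(hornerD, hornerM, hornerC, hornerX) IHa.
- by exists (p + polyC 3 * 'X + polyC 4)%R => M;
  rewrite !(hornerD, hornerM, hornerC, hornerX) IHa.
Qed.

Lemma cost_poly s : exists p : {poly nat}, forall M, p.[M]%R = cost M s.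
Proof.
elim: s => [e|e s [q IH]|e s [q IH]|s [q IH]|s1 [p IH1] s2 [q IH2]].
- have [p pE] := cost_expr_poly e.
  by exists (p + polyC 6)%R => M;
    rewrite !(hornerD, hornerM, hornerC, hornerX) pE.
- have [p pE] := cost_expr_poly e.
  by exists (p + q + polyC 3)%R => M;
    rewrite !(hornerD, hornerM, hornerC, hornerX) pE IH.
- have [p pE] := cost_expr_poly e.
  by exists (p + q + polyC 8)%R => M;
    rewrite !(hornerD, hornerM, hornerC, hornerX) pE IH.
- by exists ('X * (q + polyC 4) + polyC 1)%R => M;
  rewrite !(hornerD, hornerM, hornerC, hornerX) IH.
- by exists (p + q)%R => M;
  rewrite !(hornerD, hornerM, hornerC, hornerX) IH1 IH2.
Qed.

Definition sum_inputs (l : seq nat) : seq instr :=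
  flatten [seq [:: Const 1 i; Read 1 1; Add 0 0 1] | i <- l].

Lemma sum_inputsP P inp l o m : code_at P o (sum_inputs l) ->
  exists2 m', runs P inp (3 * size l) (o, m) (o + size (sum_inputs l), m')
    & m' 0 = m 0 + sumn [seq nth 0 inp i | i <- l]
      /\ forall i, 1 < i -> m' i = m i.
Proof.
elim: l o m => [|i l IH] o m /=.
  by move=> _; exists m; rewrite ?addn0 //; apply: runs_refl.
move=> [i0 [i1 [i2 c]]].
have [m' run [m'0 fr]] := IH _ (upd (upd m 1 (nth 0 inp i)) 0
                                   (m 0 + nth 0 inp i)) c.
exists m'; last first.
  split=> [|j ltj]; first by rewrite m'0 /upd /= addnA.
  by rewrite fr // /upd; do !case: eqP => //; lia.
rewrite mulnS; do 3!apply: runs_step; rewrite /step i0 i1 i2.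
rewrite -/(sum_inputs l) !addnS -!addSn.
set r := (X in runs _ _ _ (_, X) _).
have -> : r = upd (upd m 1 (nth 0 inp i)) 0 (m 0 + nth 0 inp i).
  by apply: funext => j; rewrite /r /upd; do !case: eqP.
exact: run.
Qed.

(** Input cell 5, the number of initial states, is skipped because [fsa_size] does not count it.
    Adding 2 gives [top < M], as [top] is [k1 + k2 + 1]. *)
Definition prologue : seq instr :=
  sum_inputs [:: 0; 1; 2; 3; 4; 6] ++ [:: Const 1 2; Add 0 0 1].

Definition bound (inp : seq nat) : nat :=
  sumn [seq nth 0 inp i | i <- [:: 0; 1; 2; 3; 4; 6]] + 2.

(** Three instructions for each of the six summands and two for the constant make 20. Only registers
    0 and 1 are written, and register 1 is [tmp 0], so no cell is marked. *)
Lemma prologueP P inp : code_at P 0 prologue ->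
  exists2 m, runs P inp 20 start (size prologue, m)
    & agree (bound inp) [::] pred0 m.
Proof.
move=> /code_at_cat[c1 /code_at_cons[i0 /code_at_cons[i1 _]]].
have [m1 run1 [m10 fr1]] := sum_inputsP inp (fun=> 0) c1.
exists (upd (upd m1 1 2) 0 (bound inp)).
  apply: runs_trans run1 (runs_step (runs_step _)).
  have -> : bound inp = m1 0 + 2 by rewrite m10.
  by rewrite /step i0 i1; apply: runs_refl.
split=> // a; rewrite /upd fr1; last lia.
by do !case: eqP => //; lia.
Qed.

Definition search_code : seq instr := compile (size prologue) 0 search_stmt.

Definition exit_address : nat := size prologue + size search_code.

(* Register 2 is [cell 0]. *)
Definition detectability_program : program :=
  prologue ++ search_code
  ++ [:: Jump 2 exit_address.+2; Halt true; Halt false].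

Local Opaque prologue search_stmt.

Lemma program_answers P inp : code_at P 0 detectability_program ->
  answers_within P inp (cost (bound inp) search_stmt + 21)
    (~~ exec inp (bound inp) [::] search_stmt pred0 0).
Proof.
move=> /code_at_cat[cp /code_at_cat[cs]].
move=> /code_at_cons[j0 /code_at_cons[j1 /code_at_cons[j2 _]]].
rewrite add0n -/exit_address in cs j0 j1 j2.
have [m2 run2 ag2] := prologueP inp cp.
have M_gt0 : 0 < bound inp by rewrite /bound addn2.
have [//|m3 run3 [_ ag3]] := compileP inp M_gt0 (rho := [::]) cs _ ag2.
set b := exec _ _ _ _ _ 0.
(* One more step for the final jump: a marked cell 0 leads to [Halt false], an unmarked one falls
   through to [Halt true]. *)
have [n le_n nE] : runs P inp (20 + cost (bound inp) search_stmt + 1) start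
    (if b then exit_address.+2 else exit_address.+1, m3).
  apply: runs_trans (runs_trans run2 run3) (runs_step _).
  rewrite /step j0 (ag3 0) -/b; case: b; exact: runs_refl.
exists n; first by apply: leq_trans le_n _; rewrite addnAC addnC.
rewrite nE; case: (b); [exact: j2 | exact: j1].
Qed.

Lemma bound_encode S k1 k2 : bound (encode S k1 k2) = fsa_size S + k1 + k2 + 2.
Proof. by rewrite /bound /fsa_size /=; lia. Qed.

Theorem theorem5 :
  exists (P : program) (p : {poly nat}),
    forall (S : fsa) (k1 k2 : nat),
      exists b : bool,
        answers_within P (encode S k1 k2) (p.[fsa_size S + k1 + k2]%R) b /\
        (b = true <-> detectable S k1 k2).
Proof.
have [q qE] := cost_poly search_stmt.
(* The loop bound is the size measure plus 2, hence the composition with ['X + 2]; the constant 21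
   pays for the prologue and the final jump. *)
exists detectability_program, ((q + polyC 21) \Po ('X + polyC 2))%R => S k1 k2.
exists (~~ exec (encode S k1 k2) (fsa_size S + k1 + k2 + 2) [::] search_stmt pred0 0).
split.
  have -> n : ((q + polyC 21) \Po ('X + polyC 2)).[n]%R
      = cost (n + 2) search_stmt + 21.
    by rewrite horner_comp hornerD qE hornerC hornerD hornerX hornerC.
  rewrite -bound_encode; apply: program_answers; exact: code_at_self.
rewrite detectableP -reach_ambiguous.
rewrite -(@search_stmtP _ _ _ (fsa_size S + k1 + k2 + 2)).
- by split=> [/negP | /negP].
- by rewrite /fsa_size; lia.
- by rewrite /fsa_size; lia.
- by rewrite /fsa_size /top; lia.
Qed.
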